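(* Let $X$ be a subshift. If there exists a positive integer $n$ for which $|F_X(n)| = 1$, then $X$ is a full shift.
   Context: Let $A$ be a finite set (the alphabet). A subshift on $A$ is a shift-invariant subset $X$ of $A^{\mathbb{Z}}$ that is closed in the product topology. The language $L(X)$ is the set of all finite words which appear in points of $X$, and $L_n(X) = L(X)\cap A^n$. For $w \in L(X)$, the follower set $F_X(w)$ is the set of all right-infinite sequences $s \in A^{\mathbb{N}}$ such that the infinite word $ws$ occurs in some point of $X$. For a positive integer $n$, $F_X(n) = \{F_X(w) : w \in L_n(X)\}$ (a set of sets), so $|F_X(n)|$ is the number of distinct follower sets of words of length $n$ in $X$. A subshift $X \subseteq A^{\mathbb{Z}}$ is a full shift if $X = B^{\mathbb{Z}}$ for some $B \subseteq A$ (necessarily, $B$ is the set of letters of $A$ that actually appear in points of $X$). *)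

(* Defs.v *)
From mathcomp Require Import all_boot all_order all_algebra.
From mathcomp Require Import all_classical.
From mathcomp Require Import all_analysis.

Set Implicit Arguments.
Unset Strict Implicit.
Unset Printing Implicit Defensive.

Import GRing.Theory Num.Theory.
Local Open Scope classical_set_scope.
Local Open Scope ring_scope.

(* A^Z; A is discrete, and [closed] below refers to the product topology. *)
Definition biseq (A : finType) : Type :=
  prod_topology (fun _ : int => discrete_topology A).

Definition shift (A : finType) (x : biseq A) : biseq A := fun i => x (i + 1).

Definition shift_invariant (A : finType) (X : set (biseq A)) : Prop :=
  @shift A @` X = X.

Definition subshift (A : finType) (X : set (biseq A)) : Prop :=
  shift_invariant X /\ closed X.

(* The default [x i] of [nth] is never returned, since [k < size w]. *)
Definition word_appears (A : finType) (w : seq A) (x : biseq A) : Prop :=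
  exists i : int, forall k : nat,
    (k < size w)%N -> x (i + k%:Z) = nth (x i) w k.

Definition ray_appears (A : finType) (s : nat -> A) (x : biseq A) : Prop :=
  exists i : int, forall k : nat, x (i + k%:Z) = s k.

(* The concatenation ws: past the end of w, [nth] returns its default, which
   is the letter of s at position [k - size w]. *)
Definition wcat (A : finType) (w : seq A) (s : nat -> A) : nat -> A :=
  fun k => nth (s (k - size w)%N) w k.

Definition language (A : finType) (X : set (biseq A)) : set (seq A) :=
  [set w | exists2 x, X x & word_appears w x].

Definition language_n (A : finType) (X : set (biseq A)) (n : nat) :
  set (seq A) := language X `&` [set w | size w = n].

Definition follower (A : finType) (X : set (biseq A)) (w : seq A) :
  set (nat -> A) := [set s | exists2 x, X x & ray_appears (wcat w s) x].

Definition follower_n (A : finType) (X : set (biseq A)) (n : nat) :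
  set (set (nat -> A)) := follower X @` language_n X n.

Definition full_shift (A : finType) (X : set (biseq A)) : Prop :=
  exists B : {set A}, X = [set x | forall i : int, (x i : A) \in B].

(* Main.v *)
Require Import Defs.
From mathcomp Require Import all_boot all_order all_algebra.
From mathcomp Require Import all_classical.
From mathcomp Require Import all_analysis.
From mathcomp Require Import zify.

(** Let [F] be the common follower set of all words of length [n]. Every right
    half of a point of [X] lies in [F]. If [a] occurs in [X] and [s] lies in
    [F], choose a word [w] of length [n] of the language that ends in [a]: as
    [F] is the follower set of [w], some point of [X] contains [w s], hence
    [a s], and therefore [a s] lies in [F]. So [F] is stable under prepending
    letters of [X]; every finite word over these letters occurs in [X], and [X],
    being closed, is a full shift. *)

Import GRing.Theory.

Local Open Scope classical_set_scope.
Local Open Scope card_scope.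

Lemma card_eq_I1 (T : Type) (S : set T) : S #= `I_1 -> exists t, S = [set t].
Proof.
move=> /card_set_bijP[f [fS finj fsurj]].
have f0 u : S u -> f u = 0 by move=> /fS /=; case: (f u).
have [t St _] := fsurj 0 (erefl : 0 < 1).
exists t; apply/seteqP; split => [u Su /=|_ ->//].
by apply: finj; rewrite ?inE// !f0.
Qed.

(** The product topology is the supremum of the topologies pulled back along the coordinates, so
    convergence is checked one coordinate at a time. *)
Lemma biseq_cvg (A : finType) (y : nat -> biseq A) (x : biseq A) :
  (forall i, \forall N \near \oo, y N i = x i) -> y @ \oo --> x.
Proof.
move=> yx; apply/cvg_sup => i U [B [[C oC <-] Cx] CU].
by apply: filterS (yx i) => N yxN; apply: CU; rewrite /= yxN.
Qed.

Lemma shift_invariant_translate (A : finType) (X : set (biseq A)) (m : int)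
    (x : biseq A) :
  shift_invariant X -> X x -> X (fun i => x (i + m)%R).
Proof.
move=> sX.
have translate_pos (k : nat) z : X z -> X (fun i => z (i + k%:Z)%R).
  move=> Xz; elim: k => [|k IH].
    by under eq_fun do rewrite addr0.
  rewrite -sX; exists (fun i => z (i + k%:Z)%R) => //.
  by apply/funext => i; rewrite /Defs.shift; congr z; lia.
have translate_neg (k : nat) z : X z -> X (fun i => z (i - k%:Z)%R).
  move=> Xz; elim: k => [|k IH].
    by under eq_fun do rewrite subr0.
  (* The translate by [- k] is the shift of some [u] in [X]; this [u] is the translate by
     [- k.+1]. *)
  move: IH; rewrite -{1}sX => -[u Xu uz].
  congr X: Xu; apply/funext => i.
  rewrite -[i in LHS](subrK 1%R) -[LHS]/(Defs.shift u (i - 1)%R) uz.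
  by congr z; lia.
case: m => k; first exact: translate_pos.
by rewrite NegzE; exact: translate_neg.
Qed.

Section ConstantFollower.
Variables (A : finType) (X : set (biseq A)) (n : nat) (F : set (nat -> A)).
Hypotheses (sX : shift_invariant X) (n_gt0 : (0 < n)%N).
Hypothesis followerF : forall w, language_n X n w -> follower X w = F.

Lemma window_language (x : biseq A) (i : int) :
  X x -> language_n X n (mkseq (fun k => x (i + k%:Z)%R) n).
Proof.
move=> Xx; split; last by rewrite /= size_mkseq.
by exists x => //; exists i => k; rewrite size_mkseq => kn; rewrite nth_mkseq.
Qed.

(** The [n] letters just before position [i] form a word followed by this ray. *)
Lemma ray_follower (x : biseq A) (i : int) :
  X x -> F (fun k => x (i + k%:Z)%R).
Proof.
move=> Xx; rewrite -(followerF _ (window_language x (i - n%:Z)%R Xx)).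
exists x => //; exists (i - n%:Z)%R => k; rewrite /wcat size_mkseq.
have [kn|nk] := ltnP k n; first by rewrite nth_mkseq.
by rewrite nth_default ?size_mkseq//; congr x; lia.
Qed.

Lemma follower_cons (x : biseq A) (i : int) (s : nat -> A) :
  X x -> F s -> F (fun k => if k is k'.+1 then s k' else x i).
Proof.
move=> Xx Fs; move: (Fs).
(* This window ends at position [i], so in [y] the letter [x i] sits at [j + n.-1], right before
   [s]. *)
rewrite -{1}(followerF _ (window_language x (i - n.-1%:Z)%R Xx)).
move=> [y Xy [j yj]].
rewrite [T in F T](_ : _ = fun k => y (j + n.-1%:Z + k%:Z)%R).
  exact: ray_follower.
apply/funext => k; rewrite -addrA -PoszD yj /wcat size_mkseq.
case: k => [|k].
  by rewrite addn0 nth_mkseq ?prednK//; congr x; lia.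
by rewrite nth_default ?size_mkseq; [congr s|]; lia.
Qed.

(** Induction on [m]: prepend [x i] to a ray that agrees with [x] from [i + 1] on. *)
Lemma follower_prefix (x : biseq A) (m : nat) :
    (exists s, F s) ->
    (forall i, exists2 z, X z & z 0%R = x i) ->
  forall i : int, exists2 s, F s & forall k, (k < m)%N -> s k = x (i + k%:Z)%R.
Proof.
move=> [s0 Fs0] xX; elim: m => [|m IH] i; first by exists s0.
have [z Xz zx] := xX i; have [s Fs sx] := IH (i + 1)%R.
eexists; first exact: (follower_cons z 0%R s Xz Fs).
case=> [|k] km; first by rewrite addr0.
by rewrite sx//; congr x; lia.
Qed.

Lemma mem_of_letters (x : biseq A) : closed X -> X !=set0 ->
  (forall i, exists2 z, X z & z 0%R = x i) -> X x.
Proof.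
move=> cX [x0 Xx0] xX.
have approx (N : nat) : exists y, X y /\
    forall i : int, (`|i| <= N)%N -> y i = x i.
  have Fne : exists s, F s by eexists; exact: (ray_follower x0 0%R Xx0).
  (* The prefix of [s] copies [x] on the positions from [- N] to [N]. *)
  have [s] := follower_prefix x (N + N).+1 Fne xX (- N%:Z)%R.
  rewrite -(followerF _ (window_language x0 0%R Xx0)) => -[y Xy [j yj]] sx.
  (* In [y] the ray [s] starts at [j + n], with the letter [x (- N)]; hence [x 0] sits at
     [j + n + N]. *)
  exists (fun i => y (i + (j + (n + N)%:Z))%R).
  split; first exact: (shift_invariant_translate _ _ _ _ sX).
  move=> i iN.
  rewrite [T in y T](_ : _ = j + (n + `|(i + N%:Z)%R|)%N%:Z)%R; last by lia.
  rewrite yj /wcat size_mkseq nth_default ?size_mkseq ?leq_addr//.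
  by rewrite addKn sx; [congr x; lia|lia].
have [y yP] := choice approx.
have := @closed_cvg nat (biseq A) \oo _ y X cX _ x; apply.
  by apply: nearW => N; have [] := yP N.
apply: biseq_cvg => i; near=> N; apply: (yP N).2.
by near: N; exact: nbhs_infty_ge.
Unshelve. all: by end_near. Qed.

End ConstantFollower.

Theorem theorem4p5 (A : finType) (X : set (biseq A)) (hX : subshift X)
  (hF : exists n : nat, (0 < n)%N /\ follower_n X n #= `I_1) :
  full_shift X.
Proof.
have [sX cX] := hX; have [n [n_gt0 /card_eq_I1[F FE]]] := hF.
have followerF w : language_n X n w -> follower X w = F.
  move=> Lw; have : follower_n X n (follower X w) by exists w.
  by rewrite FE.
have X_ne : X !=set0.
  have : follower_n X n F by rewrite FE.
  by move=> [w [[x Xx _] _] _]; exists x.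
(* By shift invariance, every letter occurring in [X] occurs at position 0. *)
exists [set a | `[< exists2 z, X z & z 0%R = a >]]%SET.
apply/seteqP; split => x /= => [Xx i|xX].
  rewrite inE; apply/asboolP; exists (fun j => x (j + i)%R).
    exact: (shift_invariant_translate _ _ _ _ sX).
  by rewrite add0r.
apply: (mem_of_letters _ _ _ _ sX n_gt0 followerF) => // i.
by have := xX i; rewrite inE => /asboolP.
Qed.
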